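(* Let $n$ and $k$ be integers with $0<k<n$, let $\delta_1,\ldots,\delta_n$ be distinct real numbers, let $t\in\mathbb{R}$ and $h>0$, and let $I$ be the smallest closed interval containing all the points $t+\delta_i h$, $1\le i\le n$, that is, $I=\{x:\min_{i}(t+\delta_i h)\le x\le\max_{i}(t+\delta_i h)\}$. Let $f$ be a real-valued function, at least $(n-1)$ times differentiable, that is $n$-times differentiable on an open set containing $I$, and suppose $|f^{(n)}(\tau)|\le M$ for all $\tau\in I$. Then the error term $$R=-\frac{1}{h^k}\sum_{j=1}^n c_j R_{n,j}$$ satisfies $$|R|\le\frac{M\,\Delta^{2n-k-1}}{\epsilon^{n-1}(n-k-1)!}\,h^{n-k}.$$
   Context: $(c_1,\ldots,c_n)\in\mathbb{R}^n$ is the unique vector satisfying $\sum_{j=1}^n c_j\delta_j^i=0$ for all $0\le i\le n-1$ with $i\ne k$, and $\sum_{j=1}^n c_j\delta_j^k=k!$ (with the convention $\delta^0=1$ for every real $\delta$; existence and uniqueness follow from invertibility of the Vandermonde matrix). $R_{n,j}=f(t+\delta_j h)-\sum_{i=0}^{n-1}f^{(i)}(t)\frac{\delta_j^i h^i}{i!}$ is the remainder in the Taylor expansion of $f$ at $t$. Consequently $R=f^{(k)}(t)-\frac{1}{h^k}\sum_{j=1}^n c_j f(t+\delta_j h)$ is the error of the formula $\frac{1}{h^k}\sum_{j=1}^n c_j f(t+\delta_j h)\approx f^{(k)}(t)$. $\Delta=\max\{|\delta_1|,\ldots,|\delta_n|\}$, $\epsilon_j=\min_{i\ne j}|\delta_j-\delta_i|$,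 and $\epsilon=\min\{\epsilon_1,\ldots,\epsilon_n\}$.
   Formalization: If t is not in I the claim fails (n=2, k=1, t=0, h=1, δ=(1,2), f=0 near I, f(0)=0, f'(0)=1, M=0 gives R=1); in that case it is also assumed that the open set contains the segments from t to each t+δ_j h and that |f^(n)|≤M on them. *)

(* Defs.v *)
From HB Require Import structures.
From mathcomp Require Import all_boot all_order all_algebra.
From mathcomp Require Import all_classical all_reals all_analysis.

Set Implicit Arguments.
Unset Strict Implicit.
Unset Printing Implicit Defensive.

Import Order.TTheory GRing.Theory Num.Theory.
Import numFieldNormedType.Exports.

Local Open Scope classical_set_scope.
Local Open Scope ring_scope.

(* Meaningful when [A] is open: the iterated derivatives of [f] at a point of
   [A] then depend only on the restriction of [f] to [A], so that [f] stands
   for a function defined on [A] only. *)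
Definition n_times_derivable (R : realType) (n : nat) (f : R -> R)
    (A : set R) : Prop :=
  forall m x, (m < n)%N -> A x -> derivable (derive1n m f) x 1.

(* Since the [delta j] are distinct and [k < n], this square linear system is
   Vandermonde and determines [c] uniquely. *)
Definition is_weights (R : realType) (n k : nat) (delta c : 'I_n -> R) : Prop :=
  (forall i, (i < n)%N -> i <> k -> \sum_(j < n) c j * delta j ^+ i = 0) /\
  \sum_(j < n) c j * delta j ^+ k = (k`!)%:R.

Definition node (R : realType) (n : nat) (t h : R) (delta : 'I_n -> R)
    (j : 'I_n) : R := t + delta j * h.

Definition taylor_remainder (R : realType) (n : nat) (f : R -> R) (t h : R)
    (delta : 'I_n -> R) (j : 'I_n) : R :=
  f (node t h delta j)
  - \sum_(i < n) derive1n i f t * (delta j ^+ i * h ^+ i / (i`!)%:R).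

Definition error_term (R : realType) (n k : nat) (f : R -> R) (t h : R)
    (delta c : 'I_n -> R) : R :=
  - (h ^+ k)^-1 * \sum_(j < n) c j * taylor_remainder f t h delta j.

(* In what follows, [sup] and [inf] are only taken of finite sets, nonempty as
   soon as [2 <= n]; they are therefore maxima and minima. *)

Definition node_interval (R : realType) (n : nat) (t h : R)
    (delta : 'I_n -> R) : set R :=
  [set x | inf (range (node t h delta)) <= x <= sup (range (node t h delta))].

Definition Delta_max (R : realType) (n : nat) (delta : 'I_n -> R) : R :=
  sup (range (fun j => `|delta j|)).

Definition eps_at (R : realType) (n : nat) (delta : 'I_n -> R) (j : 'I_n) : R :=
  inf [set `|delta j - delta i| | i in [set i | i != j]].

Definition eps_min (R : realType) (n : nat) (delta : 'I_n -> R) : R :=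
  inf (range (eps_at delta)).

Definition segment (R : realType) (x y : R) : set R :=
  [set z | Num.min x y <= z <= Num.max x y].

(* Main.v *)
Require Import Defs.
From HB Require Import structures.
From mathcomp Require Import all_boot all_order all_algebra.
From mathcomp Require Import all_classical all_reals all_analysis.
From mathcomp Require Import ring zify.

Import Order.TTheory GRing.Theory Num.Theory.
Import numFieldNormedType.Exports.

Local Open Scope classical_set_scope.
Local Open Scope ring_scope.

(** Each Taylor remainder has the Lagrange form
    [f^(n)(tau_j) (delta_j h)^n / n!], hence is at most
    [M Delta^n h^n / n!] in absolute value ([taylor_remainder_le]). What remains
    is to bound the weights.

    The moment conditions say exactly that [sum_j c_j p(delta_j) = k! p_k] for
    every polynomial [p] of degree less than [n], where [p_k] is the coefficient
    of [X^k] ([weights_poly]). Taking for [p] the product of the [X - delta_i]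
    over [i != j] kills every term of the sum but one:
    [c_j prod_(i != j) (delta_j - delta_i) = k! p_k]. The product on the left is
    at least [epsilon^(n-1)] in absolute value. By Vieta, [p_k] is up to sign an
    elementary symmetric function of degree [n-1-k] of [n-1] numbers bounded by
    [Delta], so that [|p_k| <= C(n-1, k) Delta^(n-1-k)] ([coef_prod_XsubC_le]).
    Hence [|c_j| <= k! C(n-1, k) Delta^(n-1-k) / epsilon^(n-1)] ([weight_bound]).

    Summing the [n] products of these bounds and dividing by [h^k] gives the
    announced constant, because [n k! C(n-1, k) / n! = 1 / (n-1-k)!]. *)

(** * Extrema over finite families *)

Lemma sup_range_ge {R : realType} {I : finType} (F : I -> R) (i : I) :
  F i <= sup (range F).
Proof.
apply: ub_le_sup; last by exists i.
exists (\big[Num.max/F i]_j F j) => _ [j _ <-].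
exact: le_bigmax.
Qed.

Lemma inf_range_le {R : realType} {I : finType} (F : I -> R) (i : I) :
  inf (range F) <= F i.
Proof.
apply: ge_inf; last by exists i.
exists (\big[Num.min/F i]_j F j) => _ [j _ <-].
exact: bigmin_le.
Qed.

Lemma eps_min_le_dist {R : realType} {n : nat} (delta : 'I_n -> R)
  (i j : 'I_n) : i != j -> eps_min delta <= `|delta j - delta i|.
Proof.
move=> ij; apply: le_trans (inf_range_le (eps_at delta) j) _.
apply: ge_inf; last by exists i.
by exists 0 => _ [l _ <-].
Qed.

Lemma eps_min_gt0 {R : realType} {n : nat} (delta : 'I_n -> R) :
  (1 < n)%N -> injective delta -> 0 < eps_min delta.
Proof.
move=> n1 dI.
pose F (p : 'I_n * 'I_n) := `|delta p.1 - delta p.2|.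
pose e := \big[Num.min/1]_(p | p.2 != p.1) F p.
have e0 : 0 < e.
  (* the default value 1 of the minimum only has to be positive *)
  apply: lt_bigmin => // -[j i] /= ij.
  by rewrite normr_gt0 subr_eq0; apply: contra ij => /eqP/dI /= ->.
apply: lt_le_trans e0 _; apply: lb_le_inf.
  by exists (eps_at delta (Ordinal (ltnW n1))), (Ordinal (ltnW n1)).
move=> _ [j _ <-]; apply: lb_le_inf.
  (* an infimum over the empty set would be 0: some i differs from j *)
  have : (0 < #|predC1 j|)%N.
    by rewrite cardC1 card_ord; case: n n1 {delta dI F e j} => [|[]].
  by case/card_gt0P => i ij; exists `|delta j - delta i|, i.
by move=> _ [i ij <-]; apply: (@bigmin_le_cond _ _ _ _ (j, i) _ F).
Qed.

(** * Bounding the weights *)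

(** The coefficient of [X^k] is a signed sum of the products of [size s - k]
    entries of [s], one for each choice of the [k] factors that contribute [X].
    The induction on [s] follows Pascal's rule. *)
Lemma coef_prod_XsubC_le {R : realDomainType} (D : R) (s : seq R) (k : nat) :
  (forall a, a \in s -> `|a| <= D) ->
  `|(\prod_(a <- s) ('X - a%:P))`_k| <= 'C(size s, k)%:R * D ^+ (size s - k).
Proof.
elim: s k => [|a s IHs] k sD.
  rewrite big_nil coef1 /=; case: k => [|k].
    by rewrite normr1 mulr1.
  by rewrite normr0 mul0r.
have aD : `|a| <= D by apply: sD; rewrite mem_head.
have {}IHs l : _ := IHs l (fun b bs => sD b (mem_behead (s := a :: s) bs)).
rewrite big_cons mulrBl coefB coefXM coefCM.
case: k => [|k] /=.
  rewrite sub0r normrN normrM bin0 mul1r subn0 exprS ler_pM //.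
  by have := IHs 0%N; rewrite bin0 mul1r subn0.
rewrite subSS binS natrD mulrDl; apply: le_trans (ler_normB _ _) _.
rewrite addrC lerD // normrM.
(* truncated subtraction breaks [size s - k = (size s - k.+1).+1] when
   [size s <= k], but then the coefficient vanishes *)
have [sk|ks] := leqP (size s) k.
  have := IHs k.+1; rewrite bin_small ?ltnS // !mul0r normr_le0 => /eqP ->.
  by rewrite normr0 mulr0.
rewrite mulrC -(subnSK ks) exprSr mulrA ler_pM //; exact: IHs.
Qed.

(** By linearity from the monomials: the quadrature rule [c] at the nodes
    [delta] computes the [k]-th derivative at 0 exactly on polynomials of degree
    less than [n]. *)
Lemma weights_poly {R : realType} {n k : nat} {delta c : 'I_n -> R}
  (hc : is_weights k delta c) (p : {poly R}) :
  (k < n)%N -> (size p <= n)%N ->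
  \sum_(j < n) c j * p.[delta j] = k`!%:R * p`_k.
Proof.
move=> kn pn; case: hc => hc0 hck.
under eq_bigr do rewrite (horner_coef_wide _ pn) mulr_sumr.
rewrite exchange_big /= (bigD1 (Ordinal kn)) //= [X in _ + X]big1 => [|i ik].
  rewrite addr0 -hck mulrC mulr_sumr; apply: eq_bigr => j _; ring.
under eq_bigr do rewrite mulrCA.
by rewrite -mulr_sumr hc0 ?mulr0 // => /eqP; apply/negP.
Qed.

(** The polynomial vanishing at all the [delta i] but [delta j] isolates [c j]
    in [weights_poly]; it is a multiple of the Lagrange basis polynomial. *)
Lemma weight_bound {R : realType} {n k : nat} {delta c : 'I_n -> R} (j : 'I_n) :
  (0 < k)%N -> (k < n)%N -> injective delta -> is_weights k delta c ->
  `|c j| <= (k`! * 'C(n.-1, k))%:R * Delta_max delta ^+ (n.-1 - k)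
              / eps_min delta ^+ n.-1.
Proof.
move=> k0 kn dI hc; pose s := [seq delta i | i <- enum (predC1 j)].
have sE : size s = n.-1 by rewrite size_map -cardE cardC1 card_ord.
pose p := \prod_(a <- s) ('X - a%:P).
have pn : (size p <= n)%N.
  by rewrite size_prod_XsubC sE prednK // (leq_trans _ kn).
have pE x : p.[x] = \prod_(i | i != j) (x - delta i).
  rewrite horner_prod big_map big_enum /=; apply: eq_bigr => i _.
  by rewrite hornerXsubC.
have e0 : 0 < eps_min delta by apply: eps_min_gt0; rewrite ?(leq_trans _ kn).
rewrite ler_pdivlMr ?exprn_gt0 //.
apply: (@le_trans _ _ `|c j * p.[delta j]|).
  rewrite normrM ler_wpM2l // pE normr_prod.
  have -> : n.-1 = #|predC1 j| by rewrite cardC1 card_ord.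
  rewrite -prodr_const; apply: ler_prod => i ij.
  by rewrite (ltW e0) eps_min_le_dist.
have -> : c j * p.[delta j] = k`!%:R * p`_k.
  rewrite -(weights_poly hc) // (bigD1 j) //= big1 ?addr0 // => i ij.
  by rewrite pE (bigD1 i) //= subrr mul0r mulr0.
rewrite normrM normr_nat natrM -mulrA ler_wpM2l // -sE.
apply: coef_prod_XsubC_le => _ /mapP[i _ ->].
exact: (sup_range_ge (fun i => `|delta i|)).
Qed.

(** * Taylor's formula with the Lagrange remainder *)

(** Rolle's theorem between two points in either order. Taylor's formula needs
    the zero to differ from [b], because the derivative of its auxiliary
    function has a factor [(b - z)^m] to be divided out. *)
Lemma Rolle_segment {R : realType} {g : R -> R} {a b : R} : a != b ->
  (forall z, segment a b z -> derivable g z 1) -> g a = g b ->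
  exists z, [/\ segment a b z, z != b & is_derive z 1 g 0].
Proof.
have key x y : x < y -> (forall z, x <= z <= y -> derivable g z 1) ->
    g x = g y -> exists z, x < z < y /\ is_derive z 1 g 0.
  move=> xy gd gxy; case: (@Rolle _ g x y xy) => //.
  - by move=> z /[!in_itv]/= /andP[xz zy]; apply: gd; rewrite !ltW.
  - by apply: derivable_within_continuous => z /[!in_itv]/=; exact: gd.
  - by move=> z /[!in_itv]/= ? ?; exists z.
rewrite /segment /=; case: (ltgtP a b) => // ab _ gd gab.
  have [z [/andP[az zb] dz]] := key _ _ ab gd gab.
  by exists z; rewrite lt_eqF // !ltW.
have [z [/andP[az zb] dz]] := key _ _ ab gd (esym gab).
by exists z; rewrite gt_eqF // !ltW.
Qed.

(** Viewed as a function of the centre [s] of the expansion, since Taylor's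
    formula is obtained by moving this centre. *)
Definition taylor_monomial {R : realType} (x : R) (i : nat) (s : R) : R :=
  (x - s) ^+ i / i`!%:R.

Lemma is_derive_taylor_monomialS {R : realType} (x s : R) (i : nat) :
  is_derive s 1 (taylor_monomial x i.+1) (- taylor_monomial x i s).
Proof.
have -> : taylor_monomial x i.+1 = (cst x - id) ^+ i.+1 * cst (i.+1`!%:R^-1).
  by apply/funext => z; rewrite /taylor_monomial !fctE.
have d1 : is_derive s 1 (cst x - id : R -> R) (0 - 1) by exact: is_deriveB.
have d2 := is_deriveX i.+1 d1.
have d3 := is_derive_cst (i.+1`!%:R^-1 : R) s 1.
apply: is_derive_eq (is_deriveM d2 d3) _.
rewrite /taylor_monomial !fctE factS natrM /GRing.scale /=.
field.
by rewrite nat1r !pnatr_eq0 -lt0n fact_gt0.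
Qed.

(** Moving the centre of expansion, the derivatives of consecutive terms
    telescope and only the top one survives. *)
Lemma is_derive_taylor_sum {R : realType} (f : R -> R) (x s : R) (m : nat) :
  (forall i, (i < m.+1)%N -> derivable (derive1n i f) s 1) ->
  is_derive s 1
    (fun s => \sum_(i < m.+1) derive1n i f s * taylor_monomial x i s)
    (derive1n m.+1 f s * taylor_monomial x m s).
Proof.
have dE i : derivable (derive1n i f) s 1 ->
    is_derive s 1 (derive1n i f) (derive1n i.+1 f s).
  by move=> /derivableP; rewrite derive1nS derive1E.
elim: m => [|m IHm] fd.
  have -> : (fun s => \sum_(i < 1) derive1n i f s * taylor_monomial x i s)
      = derive1n 0 f.
    by apply/funext => z; rewrite big_ord1 /taylor_monomial fact0 divr1 mulr1.
  apply: is_derive_eq (dE 0%N (fd 0%N isT)) _.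
  by rewrite /taylor_monomial fact0 divr1 mulr1.
under eq_fun do rewrite big_ord_recr /=.
have dm := is_deriveM (dE _ (fd m.+1 (ltnSn _)))
  (is_derive_taylor_monomialS x s m).
apply: is_derive_eq (is_deriveD (IHm (fun i im => fd i (leqW im))) dm) _.
by rewrite /GRing.scale /=; ring.
Qed.

(** A single use of Rolle's theorem, on the Taylor polynomial at [x] as a
    function of its centre [s], corrected by a multiple [K] of
    [(x - s)^(m+1) / (m+1)!]. The derivative of this function is
    [(f^(m+1)(s) - K) (x - s)^m / m!]. *)
Lemma taylor_lagrange {R : realType} (f : R -> R) (a x : R) (m : nat) :
  (forall s, segment a x s ->
     forall i, (i < m.+1)%N -> derivable (derive1n i f) s 1) ->
  exists2 tau, segment a x tau &
    f x - \sum_(i < m.+1) derive1n i f a * taylor_monomial x i a =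
    derive1n m.+1 f tau * taylor_monomial x m.+1 a.
Proof.
move=> fd.
pose T s := \sum_(i < m.+1) derive1n i f s * taylor_monomial x i s.
have q0 i : taylor_monomial x i.+1 x = 0.
  by rewrite /taylor_monomial subrr expr0n mul0r.
have qN0 i s : s != x -> taylor_monomial x i s != 0.
  move=> sx; rewrite /taylor_monomial mulf_neq0 ?invr_eq0 ?pnatr_eq0
    -?lt0n ?fact_gt0 //.
  by rewrite expf_neq0 // subr_eq0 eq_sym.
have Tx : T x = f x.
  rewrite /T big_ord_recl big1 => [|i _].
    by rewrite /= /taylor_monomial fact0 divr1 mulr1 addr0.
  by rewrite lift0 q0 mulr0.
have [ax|ax] := eqVneq a x.
  exists a; first by rewrite /segment /= -ax minxx maxxx lexx.
  by rewrite -/(T a) ax Tx subrr q0 mulr0.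
(* chosen so that [phi a = f x = phi x] *)
pose K := (f x - T a) / taylor_monomial x m.+1 a.
pose phi s := T s + K * taylor_monomial x m.+1 s.
have dphi s : segment a x s ->
    is_derive s 1 phi ((derive1n m.+1 f s - K) * taylor_monomial x m s).
  move=> /fd /is_derive_taylor_sum -/(_ x) dT.
  have dq := is_deriveM (is_derive_cst K s 1)
    (is_derive_taylor_monomialS x s m).
  apply: is_derive_eq (is_deriveD dT dq) _.
  by rewrite /GRing.scale /=; ring.
have [||tau [tauI taux dtau]] := @Rolle_segment _ phi _ _ ax.
- by move=> s /dphi ds; exact: ex_derive.
- by rewrite /phi q0 mulr0 addr0 Tx divfK ?qN0 // addrC subrK.
exists tau => //.
have := dphi _ tauI => /@derive_val; rewrite (@derive_val _ _ _ _ _ _ _ dtau).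
move/esym/eqP; rewrite mulf_eq0 (negPf (qN0 _ _ taux)) orbF subr_eq0 => /eqP ->.
by rewrite divfK ?qN0.
Qed.

Lemma taylor_remainder_le {R : realType} (n : nat) (f : R -> R) (t h : R)
  (delta : 'I_n -> R) (U : set R) (M : R) (j : 'I_n) :
  0 < h -> n_times_derivable n f U ->
  (forall tau, segment t (node t h delta j) tau ->
     U tau /\ `|derive1n n f tau| <= M) ->
  `|taylor_remainder f t h delta j| <=
    M * (Delta_max delta ^+ n * h ^+ n / n`!%:R).
Proof.
case: n delta j => [|m] delta j; first by case: j.
move=> h0 fU hM; set x := node t h delta j in hM *.
have xt : x - t = delta j * h by rewrite /x /node addrAC subrr add0r.
have [|tau tauI E] := @taylor_lagrange R f t x m.
  by move=> s sI i im; apply: fU => //; have [] := hM _ sI.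
have -> : taylor_remainder f t h delta j =
    derive1n m.+1 f tau * taylor_monomial x m.+1 t.
  rewrite -E /taylor_remainder; congr (_ - _); apply: eq_bigr => i _.
  by rewrite /taylor_monomial xt exprMn.
rewrite normrM ler_pM //; first by have [] := hM _ tauI.
rewrite /taylor_monomial xt exprMn normrM normfV normr_nat ler_wpM2r //.
rewrite normrM !normrX (gtr0_norm h0) ler_wpM2r ?exprn_ge0 ?(ltW h0) //.
have dD := sup_range_ge (fun i => `|delta i|) j.
by rewrite lerXn2r ?nnegrE // (le_trans _ dD).
Qed.

(** * The error bound *)

Theorem theorem1 (R : realType) (n k : nat) (hk0 : (0 < k)%N) (hkn : (k < n)%N)
  (delta : 'I_n -> R) (hdelta : injective delta)
  (t h : R) (hh : 0 < h)
  (c : 'I_n -> R) (hc : is_weights k delta c)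
  (f : R -> R) (D : set R) (hD : open D) (htD : D t)
  (hfD : n_times_derivable n.-1 f D)
  (U : set R) (hU : open U) (hUD : U `<=` D)
  (hIU : node_interval t h delta `<=` U)
  (hfU : n_times_derivable n f U)
  (M : R)
  (hM : forall tau, node_interval t h delta tau -> `|derive1n n f tau| <= M)
  (* void when t lies in the interval of the nodes; the bound fails without it
     otherwise *)
  (hgap : ~ node_interval t h delta t ->
     forall (j : 'I_n) (tau : R), segment t (node t h delta j) tau ->
       U tau /\ `|derive1n n f tau| <= M) :
  `|error_term k f t h delta c| <=
    M * Delta_max delta ^+ (2 * n - k - 1)
      / (eps_min delta ^+ (n - 1) * ((n - k - 1)`!)%:R) * h ^+ (n - k).
Proof.
have onseg j tau : segment t (node t h delta j) tau ->
    U tau /\ `|derive1n n f tau| <= M.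
  (* if [t] lies in the interval of the nodes, then so does the segment, by
     convexity *)
  have [tI|tI] := pselect (node_interval t h delta t); last exact: hgap.
  move=> tauI; suff tauJ : node_interval t h delta tau.
    by split; [exact: hIU|exact: hM].
  case/andP: tauI => tau1 tau2; case/andP: tI => t1 t2; apply/andP; split.
    by apply: le_trans tau1; rewrite le_min t1 inf_range_le.
  by apply: le_trans tau2 _; rewrite ge_max t2 sup_range_ge.
have e0 : 0 < eps_min delta by apply: eps_min_gt0; rewrite ?(leq_trans _ hkn).
set Dl := Delta_max delta; set e := eps_min delta in e0 *.
have n0 : (0 < n)%N by exact: leq_trans hkn.
have [m nE] : exists m, n = (k + m).+1.
  by exists (n - k.+1)%N; rewrite -addSn subnKC.
rewrite /error_term normrM normrN normfV normrX (gtr0_norm hh).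
rewrite -ler_pdivlMl ?invr_gt0 ?exprn_gt0 // invrK.
apply: le_trans (ler_norm_sum _ _ _) _.
pose C := (k`! * 'C(n.-1, k))%:R * Dl ^+ (n.-1 - k) / e ^+ n.-1.
pose B := M * (Dl ^+ n * h ^+ n / n`!%:R).
apply: (@le_trans _ _ (\sum_(j < n) C * B)).
  apply: ler_sum => j _; rewrite normrM ler_pM //; first exact: weight_bound.
  exact: taylor_remainder_le hh hfU (onseg j).
(* the two sides are equal, by [n k! C(n-1, k) m! = n!] with [m = n-1-k] *)
rewrite sumr_const card_ord le_eqVlt; apply/orP; left; apply/eqP.
have -> : (2 * n - k - 1 = m + n)%N by lia.
have -> : (n - k - 1 = m)%N by lia.
rewrite subn1 /C /B; have -> : (n.-1 - k = m)%N by lia.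
have nfact : n`!%:R = n%:R * ((k`! * 'C(n.-1, k))%:R * m`!%:R) :> R.
  rewrite -!natrM; congr _%:R; rewrite -{1}(prednK n0) factS prednK //.
  congr (_ * _)%N; rewrite -(@bin_fact n.-1 k); last by lia.
  by rewrite nE /= addKn mulnCA mulnA.
have : n`!%:R != 0 :> R by rewrite pnatr_eq0 -lt0n fact_gt0.
rewrite nfact !mulf_eq0 !negb_or => /and3P[nN0 wN0 mN0].
have eN0 : e ^+ n.-1 != 0 by rewrite expf_neq0 // gt_eqF.
have hE : h ^+ n = h ^+ k * h ^+ (n - k) by rewrite -exprD subnKC // ltnW.
rewrite exprD hE -[LHS]mulr_natl.
move: (_ * 'C(_, _))%:R wN0 (Dl ^+ n) (e ^+ n.-1) eN0 => w wN0 Dn en eN0.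
by field; rewrite nN0 wN0 mN0 eN0.
Qed.
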